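(* Let $X$ and $X'$ be independent identically distributed real random variables with distribution function $F$, $\mathbb E X=0$ and $\mathbb E X^2<\infty$. Put $\sigma^2(z)=\mathbb E X^2\mathbf 1(|X|\ge z)$ and $\sigma_s^2(z)=\mathbb E(X-X')^2\mathbf 1(|X-X'|\ge z)$, $z\ge0$. Then $$\sigma_s^2(z)\le2\sigma^2(\alpha z)+2\sigma^2((1-\alpha)z),\qquad z\ge0,\ \alpha\in[0,1].$$ In particular $\sigma_s^2(z)\le4\sigma^2(z/2)$ for all $z\ge0$, and the constant $4$ is best possible: for every $z>0$, $\sup\sigma_s^2(z)/\sigma^2(z/2)=4$, where the supremum is over all distributions of $X$ with $\mathbb E X=0$ (and finite second moment), and it is delivered by the two-point distributions $\mathbb P(X=qz)=p$, $\mathbb P(X=-pz)=q=1-p$ as $p\to\frac12+$. *)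

(* Defs.v *)
From HB Require Import structures.
From mathcomp Require Import all_boot all_order all_algebra.
From mathcomp Require Import all_classical all_reals all_analysis.
Set Implicit Arguments. Unset Strict Implicit. Unset Printing Implicit Defensive.
Import Order.TTheory GRing.Theory Num.Theory.
Import numFieldNormedType.Exports.
Local Open Scope classical_set_scope.
Local Open Scope ring_scope.
Local Open Scope ereal_scope.

Section Defs.
Context {d : measure_display} {T : measurableType d} {R : realType}.
Variable P : probability T R.

Definition independent_rv (X X' : T -> R) : Prop :=
  forall A B : set R, measurable A -> measurable B ->
    P (X @^-1` A `&` X' @^-1` B) = P (X @^-1` A) * P (X' @^-1` B).

Definition identically_distributed (X X' : T -> R) : Prop :=
  forall A : set R, measurable A -> P (X @^-1` A) = P (X' @^-1` A).

Definition centered_L2 (X : T -> R) : Prop :=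
  [/\ measurable_fun setT X,
      P.-integrable setT (EFin \o X),
      \int[P]_w (X w)%:E = 0
    & \int[P]_w ((X w) ^+ 2)%:E < +oo].

Definition iid_centered_L2 (X X' : T -> R) : Prop :=
  [/\ centered_L2 X, measurable_fun setT X',
      independent_rv X X' & identically_distributed X X'].

Definition sigma2 (X : T -> R) (z : R) : \bar R :=
  \int[P]_w ((X w) ^+ 2 * (z <= `|X w|)%R%:R)%:E.

Definition sigma2s (X X' : T -> R) (z : R) : \bar R :=
  \int[P]_w ((X w - X' w) ^+ 2 * (z <= `|X w - X' w|)%R%:R)%:E.

End Defs.

(* Main.v *)
(** Put n(x) = 1(|x| >= a) + 1(|x| >= b) with a, b >= 0.  A case analysis gives
    (x - y)^2 1(|x - y| >= a + b) <= (x - y) (x n(x) - y n(y)) for all real x, y.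
    At (X, X'), the cross terms X' X n(X) and X X' n(X') on the right have
    expectation zero because X and X' are independent and centered, so the right
    side has expectation 2 E X^2 n(X) = 2 sigma^2(a) + 2 sigma^2(b).

    For the two-point law with 1/2 < p < 1, sigma^2(z/2) = p^2 z^2 (1 - p), while
    sigma_s^2(z) is at least z^2 P(X <> X') = 2 z^2 p (1 - p); the ratio is at
    least 2/p, which tends to 4 as p -> 1/2+. *)
Require Import Defs.
From HB Require Import structures.
From mathcomp Require Import all_boot all_order all_algebra ring lra.
From mathcomp Require Import all_classical all_reals all_analysis.
From mathcomp Require Import measurable_realfun.
Import Order.TTheory GRing.Theory Num.Theory.
Import numFieldNormedType.Exports.
Local Open Scope classical_set_scope.
Local Open Scope ring_scope.
Local Open Scope ereal_scope.

(** * The pointwise inequality for the truncated square *)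

Definition truncation_count {R : realDomainType} (a b x : R) : R :=
  ((a <= `|x|)%R%:R + (b <= `|x|)%R%:R)%R.

(** For y <= x the factor x - y cancels, leaving (x - y) 1(x - y >= a + b) <= x n(x) - y n(y). Since
    t n(t) is nondecreasing, only x - y >= a + b matters. If x and y have the same sign, the one of
    larger modulus has n = 2 and the right side is at least 2 (x - y). If the signs differ, then |x|
    + |y| >= a + b: either both counts are at least 1, or one is 0, and then the other is 2 and
    belongs to the larger modulus. *)
Lemma sqr_diff_truncated_le (R : realFieldType) (a b x y : R) :
  (0 <= a)%R -> (0 <= b)%R ->
  ((x - y) ^+ 2 * (a + b <= `|x - y|)%R%:R <=
   (x - y) * (x * truncation_count a b x - y * truncation_count a b y))%R.
Proof.
wlog yx : x y / (y <= x)%R => [hwlog a0 b0|a0 b0].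
  have [|/ltW xy] := leP y x; first by move=> /hwlog; exact.
  by rewrite distrC -sqrrN -[leRHS]mulrNN !opprB; exact: hwlog.
rewrite expr2 -mulrA ler_wpM2l ?subr_ge0// /truncation_count.
rewrite (ger0_norm (x := (x - y)%R)) ?subr_ge0//.
have [x0|x0] := leP 0%R x; [rewrite (ger0_norm x0)|rewrite (ltr0_norm x0)];
(have [y0|y0] := leP 0%R y; [rewrite (ger0_norm y0)|rewrite (ltr0_norm y0)]);
(* Once the signs of x, y and all five indicators are fixed, every remaining goal is linear. *)
do 2![case: (leP a _) => ?]; do 2![case: (leP b _) => ?];
case: (leP (a + b)%R _) => ?;
rewrite /= ?mulr0 ?mulr1 ?addr0 ?add0r; lra.
Qed.

Lemma measurable_natrb {d} {T : measurableType d} {R : realType} (b : T -> bool) :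
  measurable_fun setT b -> measurable_fun setT (fun t => (b t)%:R : R).
Proof.
move=> mb; rewrite (_ : (fun t => _) = (fun t => if b t then 1%R else 0%R)).
  exact: measurable_fun_ifT.
by apply/funext => t; case: (b t).
Qed.

Lemma measurable_norm_ge {R : realType} (a : R) :
  measurable_fun setT (fun x : R => (a <= `|x|)%R%:R : R).
Proof. by apply: measurable_natrb; apply: measurable_fun_ler. Qed.

Lemma measurable_truncation_count {R : realType} (a b : R) :
  measurable_fun setT (truncation_count a b).
Proof. by apply: measurable_funD; exact: measurable_norm_ge. Qed.

(** * Expectations under equal laws and under independence *)

Section iid.
Context {d : measure_display} {T : measurableType d} {R : realType}.
Variable P : probability T R.
Implicit Types X Y : {RV P >-> R}.

Lemma eq_distribution_integral X Y (f : R -> \bar R) :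
  identically_distributed P X Y ->
  \int[distribution P X]_x f x = \int[distribution P Y]_x f x.
Proof. by move=> XY; apply: eq_measure_integral => A mA _; exact: XY. Qed.

Lemma ge0_identically_distributed_integral X Y (f : R -> \bar R) :
  identically_distributed P X Y -> measurable_fun setT f ->
  (forall x, 0 <= f x) -> \int[P]_w f (X w) = \int[P]_w f (Y w).
Proof.
move=> XY mf f0; rewrite -[LHS](ge0_integral_distribution X mf f0).
by rewrite (eq_distribution_integral X Y)// ge0_integral_distribution.
Qed.

Lemma identically_distributed_integrable X Y (f : R -> \bar R) :
  identically_distributed P X Y -> measurable_fun setT f ->
  P.-integrable setT (f \o X) -> P.-integrable setT (f \o Y).
Proof.
move=> XY mf /integrableP[_ fX]; apply/integrableP; split.
  exact: measurableT_comp.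
rewrite -(@ge0_identically_distributed_integral X Y (abse \o f))//.
  exact: measurableT_comp.
by move=> x /=; exact: abse_ge0.
Qed.

Lemma identically_distributed_integral X Y (f : R -> \bar R) :
  identically_distributed P X Y -> measurable_fun setT f ->
  P.-integrable setT (f \o X) -> \int[P]_w f (X w) = \int[P]_w f (Y w).
Proof.
move=> XY mf fX; rewrite -[LHS](integral_distribution mf fX).
rewrite (eq_distribution_integral X Y)// integral_distribution//.
exact: (@identically_distributed_integrable X).
Qed.

Lemma independent_rv_sym (X Y : T -> R) :
  independent_rv P X Y -> independent_rv P Y X.
Proof. by move=> XY A B mA mB; rewrite setIC XY// muleC. Qed.

Lemma independent_rv_comp (f : R -> R) (X Y : T -> R) :
  measurable_fun setT f ->
  independent_rv P X Y -> independent_rv P (f \o X) Y.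
Proof.
move=> mf XY A B mA mB; rewrite comp_preimage XY//.
by rewrite -[_ @^-1` _]setTI; exact: mf.
Qed.

(** Independence says that the law of (X, Y) agrees with the product of the marginal laws on
    rectangles, hence everywhere; Fubini then factors the integral of the product of the
    coordinates. *)
Lemma independent_integralM X Y :
  independent_rv P X Y ->
  P.-integrable setT (EFin \o X) -> P.-integrable setT (EFin \o Y) ->
  P.-integrable setT (fun w => (X w * Y w)%:E) ->
  \int[P]_w (X w * Y w)%:E = (\int[P]_w (X w)%:E) * (\int[P]_w (Y w)%:E).
Proof.
move=> XY iX iY iXY; pose Z w := (X w, Y w).
have mZ : measurable_fun setT Z by exact: measurable_fun_pair.
pose f (z : R * R) := (z.1 * z.2)%:E.
have mf : measurable_fun setT f.
  by apply/measurable_EFinP; apply: measurable_funM.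
have fY : \int[distribution P Y]_y y%:E = \int[P]_w (Y w)%:E.
  exact: integral_distribution.
have fX : \int[distribution P X]_y y%:E = \int[P]_w (X w)%:E.
  exact: integral_distribution.
have EYfin : \int[P]_w (Y w)%:E \is a fin_num by exact: integrable_fin_num.
have prodE : forall A, measurable A ->
    (distribution P X \x distribution P Y) A = pushforward P Z A.
  by apply: product_measure_unique => A B mA mB; exact: XY.
have intY : (distribution P Y).-integrable setT EFin.
  exact: integrable_pushforward.
have intX : (distribution P X).-integrable setT EFin.
  exact: integrable_pushforward.
have intf : (distribution P X \x distribution P Y).-integrable setT f.
  apply/integrableP; split => //.
  rewrite (@eq_measure_integral _ _ _ _ (pushforward P Z)); last first.
    by move=> A mA _; exact: prodE.
  by have /integrableP[] := @integrable_pushforward _ _ _ _ _ _ mZ P setT f mf iXY measurableT.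
transitivity (\int[pushforward P Z]_z f z).
  by rewrite integral_pushforward.
transitivity (\int[distribution P X \x distribution P Y]_z f z).
  by apply: eq_measure_integral => A mA _; rewrite [RHS]prodE.
rewrite -integral12_prod_meas1//.
(* The inner integral is x E Y; [fine] turns E Y into a real scalar that can be pulled out. *)
transitivity (\int[distribution P X]_x (x%:E * (fine (\int[P]_w (Y w)%:E))%:E)).
  apply: eq_integral => x _; rewrite /fubini_F fineK// -fY.
  by rewrite -integralZl.
by rewrite integralZr// fX fineK.
Qed.

End iid.

(** * The upper bound by symmetrization *)

Lemma truncation_count_ge0 {R : realDomainType} (a b x : R) :
  (0 <= truncation_count a b x)%R.
Proof. by rewrite addr_ge0. Qed.

Lemma truncation_count_le2 {R : realDomainType} (a b x : R) :
  (truncation_count a b x <= 2)%R.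
Proof.
by rewrite /truncation_count -natrD ler_nat; do 2!case: (_ <= _)%R.
Qed.

Section symmetrization.
Context {d : measure_display} {T : measurableType d} {R : realType}.
Variable P : probability T R.
Implicit Types X Y : {RV P >-> R}.

Lemma sqr_integrable X : \int[P]_w ((X w) ^+ 2)%:E < +oo ->
  P.-integrable setT (fun w => (X w ^+ 2)%:E).
Proof.
move=> X2; apply/integrableP; split.
  by apply/measurable_EFinP; exact: measurable_funX.
by under eq_integral do rewrite gee0_abs ?lee_fin ?sqr_ge0//.
Qed.

Lemma sigma2_ge0 (X : T -> R) (z : R) : 0 <= sigma2 P X z.
Proof.
by apply: integral_ge0 => w _; rewrite lee_fin mulr_ge0 ?sqr_ge0.
Qed.

Lemma integral_sqr_truncation_count X (a b : R) :
  \int[P]_w (X w ^+ 2 * truncation_count a b (X w))%:E =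
  sigma2 P X a + sigma2 P X b.
Proof.
have msqr c : measurable_fun setT
    (fun w => (X w ^+ 2 * (c <= `|X w|)%R%:R)%:E : \bar R).
  apply/measurable_EFinP; apply: measurable_funM; first exact: measurable_funX.
  by apply: (measurableT_comp (measurable_norm_ge c)).
rewrite /sigma2 -ge0_integralD//; last 2 first.
- by move=> w _; rewrite lee_fin mulr_ge0 ?sqr_ge0.
- by move=> w _; rewrite lee_fin mulr_ge0 ?sqr_ge0.
by apply: eq_integral => w _; rewrite /truncation_count mulrDr EFinD.
Qed.

(** The majorant (X - Y) (g(X) - g(Y)), with g(x) = x n(x), expands into four products. Each is
    shown integrable first, so that its expectation may be split term by term. *)
Lemma sigma2s_le_sigma2D X Y (a b : R) :
  centered_L2 P X -> independent_rv P X Y -> identically_distributed P X Y ->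
  (0 <= a)%R -> (0 <= b)%R ->
  sigma2s P X Y (a + b) <= 2%:E * sigma2 P X a + 2%:E * sigma2 P X b.
Proof.
move=> [_ iX EX X2] indXY XY a0 b0.
have iY : P.-integrable setT (EFin \o Y).
  exact: (@identically_distributed_integrable _ _ _ _ X).
have EY : \int[P]_w (Y w)%:E = 0.
  by rewrite -EX; apply/esym/(@identically_distributed_integral _ _ _ _ X Y EFin).
have iX2 := sqr_integrable X X2.
have msqr : measurable_fun setT (fun x : R => (x ^+ 2)%:E).
  by apply/measurable_EFinP; exact: measurable_funX.
have iY2 : P.-integrable setT (fun w => (Y w ^+ 2)%:E).
  exact: (identically_distributed_integrable P X Y (fun x => (x ^+ 2)%:E)).
set n := truncation_count a b.
have n2 x : (0 <= n x <= 2)%R by rewrite truncation_count_ge0 truncation_count_le2.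
have mn : measurable_fun setT n := measurable_truncation_count a b.
pose g x := (x * n x)%R.
have mg : measurable_fun setT g by exact: measurable_funM.
have mgc (Z : {RV P >-> R}) : measurable_fun setT (g \o Z) by exact: measurableT_comp.
(* Domination by |g(x)| <= 2 |x|. *)
have ig (Z : {RV P >-> R}) : P.-integrable setT (EFin \o Z) ->
    P.-integrable setT (EFin \o (g \o Z)).
  move=> iZ; have i2Z := integrableZl measurableT 2 iZ.
  apply: (le_integrable measurableT _ _ i2Z) => [|w _ /=].
    exact/measurable_EFinP.
  rewrite lee_fin /g !normrM mulrC ler_wpM2r// !ger0_norm//.
  by have /andP[] := n2 (Z w).
  by have /andP[] := n2 (Z w).
(* Domination by |g(z) w| <= 2 |z| |w| <= z^2 + w^2; this covers the diagonal products (Z = W) as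
   well as the cross ones. *)
have iM (Z W : {RV P >-> R}) : P.-integrable setT (fun w => (Z w ^+ 2)%:E) ->
    P.-integrable setT (fun w => (W w ^+ 2)%:E) ->
    P.-integrable setT (fun w => (g (Z w) * W w)%:E).
  move=> iZ iW; have iZW := integrableD measurableT iZ iW.
  apply: (le_integrable measurableT _ _ iZW) => [|w _ /=].
    by apply/measurable_EFinP; apply: measurable_funM => //; exact: mgc.
  rewrite lee_fin /g [leRHS]ger0_norm ?addr_ge0 ?sqr_ge0//.
  rewrite !normrM (ger0_norm (proj1 (andP (n2 (Z w))))).
  rewrite -(real_normK (num_real (Z w))) -(real_normK (num_real (W w))).
  have /andP[n0 nle2] := n2 (Z w).
  have zw0 : (0 <= `|Z w| * `|W w|)%R by rewrite mulr_ge0.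
  have := sqr_ge0 (`|Z w| - `|W w|)%R.
  by nra.
have E0 (Z W : {RV P >-> R}) : independent_rv P Z W ->
    P.-integrable setT (EFin \o Z) -> P.-integrable setT (EFin \o W) ->
    P.-integrable setT (fun w => (Z w ^+ 2)%:E) ->
    P.-integrable setT (fun w => (W w ^+ 2)%:E) -> \int[P]_w (W w)%:E = 0 ->
    \int[P]_w (g (Z w) * W w)%:E = 0.
  move=> indZW iZ iW iZ2 iW2 EW.
  have indgZW := independent_rv_comp P g Z W mg indZW.
  rewrite -[RHS](mule0 (\int[P]_w ((g \o Z) w)%:E)) -EW.
  by apply: (independent_integralM P (mfun_Sub (mem_set (mgc Z))) W) => //; [exact: ig|exact: iM].
have EXgX : \int[P]_w (g (X w) * X w)%:E = sigma2 P X a + sigma2 P X b.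
  rewrite -integral_sqr_truncation_count; apply: eq_integral => w _.
  by congr EFin; rewrite /g mulrAC -expr2.
have EYgY : \int[P]_w (g (Y w) * Y w)%:E = sigma2 P X a + sigma2 P X b.
  rewrite -EXgX; apply/esym.
  apply: (identically_distributed_integral P X Y (fun x => (g x * x)%:E)) => //.
    by apply/measurable_EFinP; exact: measurable_funM.
  exact: iM.
have iXX := iM X X iX2 iX2; have iYY := iM Y Y iY2 iY2.
have iXY := iM X Y iX2 iY2; have iYX := iM Y X iY2 iX2.
have iD1 := integrableD measurableT iXX iYY.
have iD2 := integrableD measurableT iXY iYX.
(* The diagonal terms and the cross terms are grouped to match [iD1] and [iD2]. *)
apply: (@le_trans _ _ (\int[P]_w
   ((g (X w) * X w)%:E + (g (Y w) * Y w)%:E -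
    ((g (X w) * Y w)%:E + (g (Y w) * X w)%:E)))).
  apply: ge0_le_integral => //.
  - by move=> w _; rewrite lee_fin mulr_ge0 ?sqr_ge0.
  - apply/measurable_EFinP; apply: measurable_funM.
      by apply: measurable_funX; exact: measurable_funB.
    apply: (measurableT_comp (measurable_norm_ge (a + b))).
    exact: measurable_funB.
  - exact: (measurable_int P (integrableB measurableT iD1 iD2)).
  - move=> w _; rewrite -!EFinD lee_fin.
    apply: (le_trans (sqr_diff_truncated_le _ a b (X w) (Y w) a0 b0)).
    by rewrite /g -/n; lra.
rewrite integralB// integralD// integralD// EXgX EYgY.
rewrite (E0 X Y)// (E0 Y X)//; last exact: independent_rv_sym.
rewrite adde0 sube0 addeACA.
have -> : 2%:E = 1 + 1 :> \bar R by [].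
by rewrite !ge0_muleDl// !mul1e.
Qed.

End symmetrization.

(** * Two-point laws: the truncated moments and their ratio *)

Lemma two_point_integral {d} {T : measurableType d} {R : realType}
    (P : probability T R) (X : {RV P >-> R}) (p c e : R) (f : R -> R) :
  c != e -> P (X @^-1` [set c]) = p%:E -> P (X @^-1` [set e]) = (1 - p)%:E ->
  measurable_fun setT f ->
  \int[P]_w (f (X w))%:E = (f c * p + f e * (1 - p))%:E.
Proof.
move=> ce + + mf; set A := X @^-1` [set c]; set B := X @^-1` [set e] => Pc Pe.
have mA : measurable A by rewrite -[A]setTI; apply: measurable_funPT.
have mB : measurable B by rewrite -[B]setTI; apply: measurable_funPT.
have AB0 : A `&` B = set0.
  by apply/seteqP; split => // w []; rewrite /A /B/= => -> /eqP; rewrite (negPf ce).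
have PAB : P (~` (A `|` B)) = 0.
  rewrite probability_setC; last exact: measurableU.
  have -> : P (A `|` B) = p%:E + (1 - p)%:E.
    by rewrite -Pc -Pe; exact: measureU.
  by rewrite -EFinD [(p + _)%R]addrC subrK subrr.
have mind (k : R) (C : set T) : measurable C ->
    P.-integrable setT (fun w => k%:E * (\1_C w)%:E).
  by move=> mC; apply: integrableZl => //; exact: integrable_indic.
(* The masses p and 1 - p exhaust the probability, so f(X) equals the simple function f(c) 1_A +
   f(e) 1_B outside a null set. *)
transitivity (\int[P]_w
  ((f c)%:E * (\1_A w)%:E + (f e)%:E * (\1_B w)%:E)); last first.
  rewrite integralD//; [|exact: mind|exact: mind].
  rewrite !integralZl//; [|exact: integrable_indic|exact: integrable_indic].
  have -> : \int[P]_w (\1_A w)%:E = p%:E by rewrite integral_indic// setIT.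
  by have -> : \int[P]_w (\1_B w)%:E = (1 - p)%:E by rewrite integral_indic// setIT.
apply: ae_eq_integral => //.
- by apply/measurable_EFinP; exact: measurableT_comp.
- exact: (measurable_int P (integrableD _ (mind _ _ mA) (mind _ _ mB))).
- exists (~` (A `|` B)); split => //; first by apply/measurableC/measurableU.
  move=> w /= wf [Aw|Bw]; apply: wf => _; rewrite !indicE.
  + rewrite mem_set// memNset ?mule1 ?mule0 ?adde0 ?Aw//.
    by move=> Bw; have : (A `&` B) w by []; rewrite AB0.
  + rewrite [w \in B]mem_set// memNset ?mule1 ?mule0 ?add0e ?Bw//.
    by move=> Aw; have : (A `&` B) w by []; rewrite AB0.
Qed.

Lemma two_point_neq {R : realType} (p z : R) :
  (0 < z)%R -> ((1 - p) * z)%R != (- (p * z))%R.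
Proof. by move=> z0; rewrite -subr_eq0 opprK -mulrDl subrK mul1r gt_eqF. Qed.

(** As p > 1/2, (1 - p) z < z/2 <= p z and only the lower atom survives the truncation. At p = 1/2
    both atoms would count and the ratio would drop to 2, so 4 is approached only in the limit. *)
Lemma two_point_sigma2 {R : realType} {d} {T : measurableType d}
    (P : probability T R) (X : {RV P >-> R}) (p z : R) :
  (1 / 2 < p)%R -> (p < 1)%R -> (0 < z)%R ->
  P (X @^-1` [set ((1 - p) * z)%R]) = p%:E ->
  P (X @^-1` [set (- (p * z))%R]) = (1 - p)%:E ->
  sigma2 P X (z / 2) = ((p * z) ^+ 2 * (1 - p))%:E.
Proof.
move=> p12 p1 z0 Xp Xq.
have norm_hi : `|(1 - p) * z|%R = ((1 - p) * z)%R.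
  by rewrite ger0_norm// mulr_ge0//; lra.
have norm_lo : `|- (p * z)|%R = (p * z)%R.
  by rewrite normrN ger0_norm// mulr_ge0//; lra.
have hi_lt : ((1 - p) * z < z / 2)%R by nra.
have lo_ge : (z / 2 <= p * z)%R by nra.
rewrite /sigma2 (two_point_integral P X p _ _
  (fun x => x ^+ 2 * (z / 2 <= `|x|)%R%:R)%R (two_point_neq p z z0))//; last first.
  apply: measurable_funM; first exact: measurable_funX.
  exact: measurable_norm_ge.
rewrite norm_hi norm_lo leNgt hi_lt lo_ge.
by rewrite /= mulr0 mul0r add0r mulr1 sqrrN.
Qed.

(** The atoms are exactly z apart, so the non-strict truncation at z keeps both events where X and Y
    sit on different atoms, each of probability p (1 - p). *)
Lemma two_point_sigma2s_ge {R : realType} {d} {T : measurableType d}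
    (P : probability T R) (X Y : {RV P >-> R}) (p z : R) :
  (0 < z)%R ->
  P (X @^-1` [set ((1 - p) * z)%R]) = p%:E ->
  P (X @^-1` [set (- (p * z))%R]) = (1 - p)%:E ->
  independent_rv P X Y -> identically_distributed P X Y ->
  (2 * z ^+ 2 * (p * (1 - p)))%:E <= sigma2s P X Y z.
Proof.
move=> z0 Xp Xq indXY XY.
set u := ((1 - p) * z)%R; set v := (- (p * z))%R.
have mpre (Z : {RV P >-> R}) c : measurable (Z @^-1` [set c]).
  by rewrite -[_ @^-1` _]setTI; apply: measurable_funPT.
pose C1 := X @^-1` [set u] `&` Y @^-1` [set v].
pose C2 := X @^-1` [set v] `&` Y @^-1` [set u].
have mC : measurable (C1 `|` C2) by apply: measurableU; apply: measurableI.
have PC : P (C1 `|` C2) = (2 * (p * (1 - p)))%:E.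
  have uv : u != v by exact: two_point_neq.
  transitivity (P C1 + P C2).
    apply: measureU; [exact: measurableI|exact: measurableI|].
    apply/seteqP; split => // w [[/= Xu _] [/= Xv _]].
    by move: uv; rewrite -Xu -Xv eqxx.
  rewrite /C1 /C2 !indXY// -!XY// Xp Xq -!EFinM -EFinD.
  by congr EFin; lra.
have -> : (2 * z ^+ 2 * (p * (1 - p)))%:E =
    \int[P]_w ((z ^+ 2)%:E * (\1_(C1 `|` C2) w)%:E).
  rewrite integralZl//; last exact: integrable_indic.
  have -> : \int[P]_w (\1_(C1 `|` C2) w)%:E = (2 * (p * (1 - p)))%:E.
    by rewrite integral_indic// setIT.
  by rewrite -EFinM; congr EFin; ring.
apply: ge0_le_integral => //.
- by move=> w _; rewrite -EFinM lee_fin mulr_ge0 ?sqr_ge0// indicE.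
- by apply/measurable_EFinP; apply: measurable_funM.
- apply/measurable_EFinP; apply: measurable_funM.
    by apply: measurable_funX; exact: measurable_funB.
  apply: (measurableT_comp (measurable_norm_ge z)).
  exact: measurable_funB.
- move=> w _; rewrite -EFinM lee_fin indicE.
  have [|_] := boolP (w \in C1 `|` C2); last first.
    by rewrite mulr0 mulr_ge0 ?sqr_ge0.
  have uvz : (u - v = z)%R by rewrite /u /v; lra.
  rewrite inE => -[[/= -> ->]|[/= -> ->]].
    by rewrite uvz ger0_norm ?lexx// ltW.
  by rewrite distrC -opprB uvz sqrrN ger0_norm ?lexx// ltW.
Qed.

(** The hypothesis (4 - eps) p < 2 is 4 - eps < 2/p without the division; it also covers eps >= 4
    with no separate case. *)
Lemma two_point_sharp {R : realType} {d} {T : measurableType d}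
    (P : probability T R) (X Y : T -> R) (p z eps : R) :
  (1 / 2 < p)%R -> (p < 1)%R -> ((4 - eps) * p < 2)%R -> (0 < z)%R ->
  iid_centered_L2 P X Y ->
  P (X @^-1` [set ((1 - p) * z)%R]) = p%:E ->
  P (X @^-1` [set (- (p * z))%R]) = (1 - p)%:E ->
  0 < sigma2 P X (z / 2) /\ (4 - eps)%:E * sigma2 P X (z / 2) < sigma2s P X Y z.
Proof.
move=> p12 p1 pe z0 [[mX _ _ _] mY indXY XY] Xp Xq.
have := @two_point_sigma2 _ _ _ P (mfun_Sub (mem_set mX)) p z p12 p1 z0 Xp Xq.
have := @two_point_sigma2s_ge _ _ _ P (mfun_Sub (mem_set mX))
  (mfun_Sub (mem_set mY)) p z z0 Xp Xq indXY XY.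
rewrite /= => les ->; split.
  by rewrite lte_fin mulr_gt0 ?subr_gt0 ?exprn_gt0 ?mulr_gt0//; lra.
apply: lt_le_trans les; rewrite -EFinM lte_fin.
have -> : ((4 - eps) * ((p * z) ^+ 2 * (1 - p)) =
           (4 - eps) * p * (z ^+ 2 * (p * (1 - p))))%R by ring.
rewrite -(mulrA 2%R) ltr_pM2r// !mulr_gt0 ?subr_gt0 ?exprn_gt0//; lra.
Qed.

(** * Existence of an i.i.d. pair with the two-point law *)

Section coin_pair.
Context {R : realType}.
Variable p : R.

(** The product measure gets a name so that a probability structure can be attached to it. *)
Definition coin_pair : set (bool * bool) -> \bar R :=
  (bernoulli_prob p \x bernoulli_prob p).

HB.instance Definition _ := Measure.on coin_pair.

Lemma coin_pairE (A B : set bool) :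
  coin_pair (A `*` B) = bernoulli_prob p A * bernoulli_prob p B.
Proof. exact: product_measure1E. Qed.

Let coin_pair_setT : coin_pair setT = 1.
Proof. by rewrite -setXTT coin_pairE !probability_setT mule1. Qed.

HB.instance Definition _ :=
  Measure_isProbability.Build _ _ _ coin_pair coin_pair_setT.

End coin_pair.

(** X and Y are the two coordinates of a pair of independent coin flips, with heads sent to (1 - p)
    z and tails to - p z. *)
Lemma exists_iid_two_point {R : realType} (p z : R) :
  (0 <= p <= 1)%R -> (0 < z)%R ->
  exists (d : measure_display) (T : measurableType d) (P : probability T R)
    (X Y : T -> R),
    [/\ iid_centered_L2 P X Y, P (X @^-1` [set ((1 - p) * z)%R]) = p%:E
      & P (X @^-1` [set (- (p * z))%R]) = (1 - p)%:E].
Proof.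
move=> p01 z0; set u := ((1 - p) * z)%R; set v := (- (p * z))%R.
have uv : u != v by exact: two_point_neq.
pose f (b : bool) : R := if b then u else v.
pose X (w : bool * bool) := f w.1; pose Y (w : bool * bool) := f w.2.
have mX : measurable_fun setT X.
  by apply: measurable_fun_ifT => //; exact: measurable_fst.
have mY : measurable_fun setT Y.
  by apply: measurable_fun_ifT => //; exact: measurable_snd.
pose P : probability _ R := coin_pair p.
have PX A : P (X @^-1` A) = bernoulli_prob p (f @^-1` A).
  rewrite (_ : X @^-1` A = (f @^-1` A) `*` setT); last first.
    by apply/seteqP; split => // -[? ?] [].
  by rewrite [LHS]coin_pairE probability_setT mule1.
have PY A : P (Y @^-1` A) = bernoulli_prob p (f @^-1` A).
  rewrite (_ : Y @^-1` A = setT `*` (f @^-1` A)); last first.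
    by apply/seteqP; split => // -[? ?] [].
  by rewrite [LHS]coin_pairE probability_setT mul1e.
have Xu : P (X @^-1` [set u]) = p%:E.
  rewrite PX bernoulli_probE// !diracE mem_set// memNset//=.
    by rewrite mule1 mule0 adde0.
  by move/esym/eqP; rewrite (negPf uv).
have Xv : P (X @^-1` [set v]) = (1 - p)%:E.
  rewrite PX bernoulli_probE// !diracE memNset ?mem_set//=.
    by rewrite mule1 mule0 add0e.
  by move/eqP; rewrite (negPf uv).
exists _, _, P, X, Y; split => //; split => //.
- have int g := two_point_integral P (mfun_Sub (mem_set mX)) p _ _ g uv Xu Xv.
  split => //.
  (* Both atoms have modulus at most z, so the constant z dominates X. *)
  + have icst := finite_measure_integrable_cst P z measurableT.
    apply: (le_integrable measurableT _ _ icst); first exact/measurable_EFinP.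
    move=> [b b'] _ /=; rewrite lee_fin (gtr0_norm z0) /X /f/= /u /v.
    by case: b; rewrite ?normrN normrM (gtr0_norm z0) ger_pMl// ger0_norm; lra.
  + by rewrite [LHS](int id)// /u /v; congr EFin; lra.
  + rewrite [ltLHS](int (fun x => x ^+ 2)%R) ?ltry//.
- by move=> A B mA mB; rewrite PX PY -coin_pairE.
- by move=> A mA; rewrite PX PY.
Qed.

Theorem theorem3 (R : realType) :
  (* main inequality and its special case alpha = 1/2 *)
  (forall (d : measure_display) (T : measurableType d) (P : probability T R)
          (X X' : T -> R),
     iid_centered_L2 P X X' ->
     (forall (z alpha : R), (0 <= z)%R -> (0 <= alpha <= 1)%R ->
        sigma2s P X X' z <=
          2%:E * sigma2 P X (alpha * z) + 2%:E * sigma2 P X ((1 - alpha) * z))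
     /\ (forall z : R, (0 <= z)%R ->
        sigma2s P X X' z <= 4%:E * sigma2 P X (z / 2))) /\
  (* the constant 4 is best possible: the ratio gets arbitrarily close to 4 *)
  (forall z : R, (0 < z)%R -> forall eps : R, (0 < eps)%R ->
     exists (d : measure_display) (T : measurableType d) (P : probability T R)
            (X X' : T -> R),
       [/\ iid_centered_L2 P X X', 0 < sigma2 P X (z / 2)
         & ((4 - eps)%:E * sigma2 P X (z / 2) < sigma2s P X X' z)]) /\
  (* ... and this is achieved by the two-point laws
     P(X = q z) = p, P(X = - p z) = q = 1 - p, as p -> 1/2+ *)
  (forall z : R, (0 < z)%R -> forall eps : R, (0 < eps)%R ->
     exists delta : R, (0 < delta)%R /\
     forall p : R, (1 / 2 < p)%R -> (p < 1 / 2 + delta)%R ->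
     forall (d : measure_display) (T : measurableType d) (P : probability T R)
            (X X' : T -> R),
       iid_centered_L2 P X X' ->
       P (X @^-1` [set ((1 - p) * z)%R]) = p%:E ->
       P (X @^-1` [set (- (p * z))%R]) = (1 - p)%:E ->
       0 < sigma2 P X (z / 2) /\
       (4 - eps)%:E * sigma2 P X (z / 2) < sigma2s P X X' z).
Proof.
have sharp (eps : R) : (0 < eps)%R -> exists2 delta : R, (0 < delta)%R &
    forall p : R, (1 / 2 < p)%R -> (p < 1 / 2 + delta)%R ->
      (p < 1)%R /\ ((4 - eps) * p < 2)%R.
  (* The bound 1/2 gives p < 1. The bound eps/8 gives 4 p < 2 + eps/2 < 2 + eps p, the last step by
     p > 1/2. *)
  move=> eps0; exists (Num.min (1 / 2) (eps / 8))%R.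
    by rewrite lt_min; apply/andP; split; lra.
  move=> p p12; rewrite -ltrBlDl lt_min => /andP[pa pb].
  by split; [lra|nra].
split; [|split].
- move=> d T P X X' [cX mX' ind id].
  have [mX _ _ _] := cX.
  have main a b := sigma2s_le_sigma2D P (mfun_Sub (mem_set mX))
    (mfun_Sub (mem_set mX')) a b cX ind id.
  split=> [z alpha z0 /andP[alpha0 alpha1]|z z0].
    rewrite [X in sigma2s _ _ _ X](_ : z = alpha * z + (1 - alpha) * z)%R.
      by apply: main; rewrite mulr_ge0// subr_ge0.
    by ring.
  rewrite [X in sigma2s _ _ _ X](_ : z = z / 2 + z / 2)%R; last by lra.
  apply: (le_trans (main _ _ _ _)); [by rewrite divr_ge0|by rewrite divr_ge0|].
  rewrite -ge0_muleDl ?lee_fin// -EFinD.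
  by rewrite [X in X%:E * _](_ : _ = 4)%R//; ring.
- move=> z z0 eps eps0; have [delta delta0 small] := sharp eps eps0.
  (* The witness is the midpoint of the admissible window (1/2, 1/2 + delta). *)
  have [p1 pe] : (1 / 2 + delta / 2 < 1)%R /\ ((4 - eps) * (1 / 2 + delta / 2) < 2)%R.
    by apply: small; lra.
  set p := (1 / 2 + delta / 2)%R in p1 pe.
  have p12 : (1 / 2 < p)%R by rewrite /p; lra.
  have [|d [T [P [X [Y [iid Xp Xq]]]]]] := exists_iid_two_point p z _ z0.
    by apply/andP; split; lra.
  exists d, T, P, X, Y.
  by have [] := two_point_sharp P X Y p z eps p12 p1 pe z0 iid Xp Xq.
- move=> z z0 eps eps0; have [delta delta0 small] := sharp eps eps0.
  exists delta; split => // p p12 pdelta d T P X X' iid Xp Xq.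
  have [p1 pe] := small p p12 pdelta.
  exact: two_point_sharp p z eps p12 p1 pe z0 iid Xp Xq.
Qed.
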